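(* Let $k=k_1+k_2$ and let $y(\varepsilon,x)=w(\varepsilon,x)-v(\varepsilon,x)$, where $w,v:\mathbb{R}\times\mathbb{R}^{k}\to\mathbb{R}^{k}$ are functions whose graphs represent manifolds and $y$ is $C^2$. Write $y=(y_1,y_2)\in\mathbb{R}^{k_1}\times\mathbb{R}^{k_2}$, $x=(x_1,x_2)\in\mathbb{R}^{k_1}\times\mathbb{R}^{k_2}$. Let $\epsilon>0$ and $E=[0,\epsilon]$. Let $p\in\mathbb{R}^{k}$ be such that $y(0,p)=0$, let $R>0$ and let $U=B(p,R)$ be the open ball. Assume that $y_2(0,x)=0$ for all $x\in U$. Let $$A_{11}=\frac{\partial y_1}{\partial x_1}(0,p),\qquad A_{22}=\frac{\partial^2 y_2}{\partial\varepsilon\,\partial x_2}(0,p),$$ $$\Delta_1=\left[\frac{\partial y_1}{\partial x}(E,U)-(A_{11},0)\right],\qquad \Delta_2=\left[\frac{\partial^2 y_2}{\partial\varepsilon\,\partial x}(E,U)-(0,A_{22})\right],$$ and assume that $$m(A_{11})R>\epsilon\left\|\frac{\partial y_1}{\partial\varepsilon}(E,p)\right\|+\|\Delta_1\|R,\qquad m(A_{22})R>\left\|\frac{\partial y_2}{\partial\varepsilon}(E,p)\right\|+\|\Delta_2\|R.$$ Let $W_\varepsilon=\{(x,w(\varepsilon,x)):x\in U\}$ and $V_\varepsilon=\{(x,v(\varepsilon,x)):x\in U\}$. Then: 1. any matrix $M\in\left[\frac{\partial y}{\partial x}(E,U)\right]$ is an isomorphism; 2. for every $\varepsilon\in(0,\epsilon]$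 the manifolds $W_\varepsilon$ and $V_\varepsilon$ have a unique intersection, which is transversal.
   Context: Norms: fix norms on $\mathbb{R}^{k_1}$ and $\mathbb{R}^{k_2}$ and equip $\mathbb{R}^{k}=\mathbb{R}^{k_1}\times\mathbb{R}^{k_2}$ with $\|(x_1,x_2)\|=\max(\|x_1\|,\|x_2\|)$; $B(p,R)$ is the ball in this norm. Matrix norms are the induced operator norms. For a set of vectors or matrices $S$, $\|S\|=\sup_{s\in S}\|s\|$. For a square matrix $A$, $m(A)=1/\|A^{-1}\|$ if $\det A\neq0$ and $m(A)=0$ otherwise. For a function $g$, $g(E,U)=\{g(\varepsilon,x):\varepsilon\in E,x\in U\}$ and $g(E,p)=\{g(\varepsilon,p):\varepsilon\in E\}$. For a set $S$ of vectors or matrices, $[S]$ denotes an interval enclosure of $S$: a product of closed intervals (one for each entry) containing $S$. Here $\frac{\partial y_1}{\partial x}$ and $\frac{\partial^2 y_2}{\partial \varepsilon\partial x}$ are matrices of sizes $k_1\times(k_1+k_2)$ and $k_2\times(k_1+k_2)$; $(A_{11},0)$ and $(0,A_{22})$ are block matrices of these sizes. The cases $k_1=0$ or $k_2=0$ are allowed, in which case the corresponding inequality is omitted. Transversality of $W_\varepsilon$ and $V_\varepsilon$ at a common point $q$ means $T_qW_\varepsilon+T_qV_\varepsilon=\mathbb{R}^{2k}$.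
   Formalization: Claim 1 is false if k2>0 (∂y/∂x(0,p) has zero lower rows); it is proved with E if k2=0, with E replaced by each single ε in (0,ϵ], and for matrices with upper block in (A11,0)+Δ1 and lower block in (0,A22)+Δ2. Smallest enclosures are used for [∂y/∂x]. *)

(* Defs.v *)
(* MathComp-Analysis; vectors of R^n are columns 'cV[R]_n and matrices act on
   the left, so that an m x n Jacobian has type 'M[R]_(m, n). *)
From HB Require Import structures.
From mathcomp Require Export all_boot all_order all_algebra.
From mathcomp Require Export all_classical all_reals all_analysis.

Set Implicit Arguments.
Unset Strict Implicit.
Unset Printing Implicit Defensive.

Export Order.TTheory GRing.Theory Num.Theory.
Export numFieldNormedType.Exports.

#[global] Open Scope classical_set_scope.
#[global] Open Scope ring_scope.

(* The norms on R^k1 and R^k2 are arbitrary, hence not the canonical norm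
   `|_| of matrices, which is the sup norm of the entries. *)
Definition is_norm (R : realType) (V : lmodType R) (N : V -> R) : Prop :=
  [/\ forall x, N x = 0 -> x = 0,
      forall (a : R) x, N (a *: x) = `|a| * N x
    & forall x x', N (x + x') <= N x + N x'].

Definition max_norm (R : realType) (k1 k2 : nat)
    (N1 : 'cV[R]_k1 -> R) (N2 : 'cV[R]_k2 -> R) (x : 'cV[R]_(k1 + k2)) : R :=
  Num.max (N1 (usubmx x)) (N2 (dsubmx x)).

Definition norm_ball (R : realType) (V : lmodType R) (N : V -> R) (p : V)
    (r : R) : set V :=
  [set x | N (x - p) < r].

(* The set is nonempty and bounded above when Nn and Nm are norms, so that
   [sup] is a genuine supremum. *)
Definition op_norm (R : realType) (m n : nat)
    (Nn : 'cV[R]_n -> R) (Nm : 'cV[R]_m -> R) (A : 'M[R]_(m, n)) : R :=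
  sup [set Nm (A *m x) | x in [set x | Nn x <= 1]].

Definition conorm (R : realType) (n : nat) (N : 'cV[R]_n -> R)
    (A : 'M[R]_n) : R :=
  if \det A != 0 then (op_norm N N (invmx A))^-1 else 0.

Definition set_norm (R : realType) (T : Type) (N : T -> R) (S : set T)
    : \bar R :=
  ereal_sup [set (N s)%:E | s in S].

Definition interval_matrix (R : realType) (m n : nat) (lo hi : 'M[R]_(m, n))
    : set 'M[R]_(m, n) :=
  [set M | forall i j, lo i j <= M i j <= hi i j].

Definition is_enclosure (R : realType) (m n : nat) (S B : set 'M[R]_(m, n))
    : Prop :=
  S `<=` B /\ exists lo hi, B = interval_matrix lo hi.

(* The smallest interval enclosure. *)
Definition interval_hull (R : realType) (m n : nat) (S : set 'M[R]_(m, n))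
    : set 'M[R]_(m, n) :=
  [set M | forall B, is_enclosure S B -> B M].

(* For finite-dimensional V, continuity of z |-> 'd f z u for every u is
   continuity of z |-> 'd f z in operator norm. *)
Definition is_C1 (R : realType) (V W : normedModType R) (f : V -> W) : Prop :=
  (forall z, differentiable f z) /\
  (forall u, continuous (fun z => 'd f z u)).

Definition is_C2 (R : realType) (V W : normedModType R) (f : V -> W) : Prop :=
  is_C1 f /\ (forall u, is_C1 (fun z => 'd f z u)).

(* In the next three definitions e is the parameter of the family. *)
Definition d_param (R : realType) (m n : nat) (f : R -> 'cV[R]_n -> 'cV[R]_m)
    (e : R) (x : 'cV[R]_n) : 'cV[R]_m :=
  \col_i 'D_1 (fun s : R => f s x i 0) e.

Definition d_space (R : realType) (m n : nat) (f : R -> 'cV[R]_n -> 'cV[R]_m)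
    (e : R) (x : 'cV[R]_n) : 'M[R]_(m, n) :=
  \matrix_(i, j)
    'D_(delta_mx j 0 : 'cV[R]_n) (fun z : 'cV[R]_n => f e z i 0) x.

Definition d_param_space (R : realType) (m n : nat)
    (f : R -> 'cV[R]_n -> 'cV[R]_m) (e : R) (x : 'cV[R]_n) : 'M[R]_(m, n) :=
  \matrix_(i, j) 'D_1 (fun s : R => d_space f s x i j) e.

(* g(E, U) *)
Definition image2 (A B C : Type) (g : A -> B -> C) (E : set A) (U : set B)
    : set C :=
  [set g e x | e in E & x in U].

Definition graph_over (R : realType) (m n : nat) (U : set 'cV[R]_n)
    (f : 'cV[R]_n -> 'cV[R]_m) : set 'cV[R]_(n + m) :=
  [set col_mx x (f x) | x in U].

(* Velocities at q of curves in W; this is the usual tangent space when W is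
   an embedded C^1 submanifold. *)
Definition tangent_space (R : realType) (n : nat) (W : set 'cV[R]_n)
    (q : 'cV[R]_n) : set 'cV[R]_n :=
  [set u | exists c : R -> 'cV[R]_n,
    [/\ c 0 = q, \forall t \near (0 : R), W (c t) & is_derive (0 : R) 1 c u]].

Definition transversal_at (R : realType) (n : nat) (W V : set 'cV[R]_n)
    (q : 'cV[R]_n) : Prop :=
  [set a + b | a in tangent_space W q & b in tangent_space V q] = setT.

(* Main.v *)
(* Fix e in (0, eps] and put F(x) = (y1(e, x), y2(e, x) / e).  Since y2(0, .)
   vanishes on U, the mean value theorem, applied to each component of F and
   then in the parameter to each entry of the derivative of y2, gives
   F(x) - F(x') = M (x - x') with M in diag(A11, A22) + (Delta1, Delta2).
   By the two inequalities the diagonal part dominates, so every such M is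
   invertible, and the simplified Newton map x - diag(A11, A22)^-1 F(x) is a
   contraction of a closed ball around p of radius < r into itself.  Its fixed
   point is the intersection; uniqueness and transversality follow from the
   invertibility of M.  The size of F(p) is controlled by a mean value
   inequality in the given norms. *)
Require Import Defs.
From mathcomp Require Import ring lra.

Set Implicit Arguments.
Unset Strict Implicit.
Unset Printing Implicit Defensive.

(** * Norms on R^n: comparison with the sup norm, compact balls, a fixed point *)

Lemma norm0 (R : realType) (V : lmodType R) (N : V -> R) (hN : is_norm N) :
  N 0 = 0.
Proof. by case: hN => _ hZ _; rewrite -(scale0r 0) hZ normr0 mul0r. Qed.

Lemma normN (R : realType) (V : lmodType R) (N : V -> R) (hN : is_norm N) x :
  N (- x) = N x.
Proof. by case: hN => _ hZ _; rewrite -scaleN1r hZ normrN1 mul1r. Qed.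

Lemma norm_ge0 (R : realType) (V : lmodType R) (N : V -> R) (hN : is_norm N)
  x : 0 <= N x.
Proof.
have [_ _ hD] := hN.
have := hD x (- x); rewrite subrr (norm0 hN) (normN hN) => h; lra.
Qed.

Lemma normBC (R : realType) (V : lmodType R) (N : V -> R) (hN : is_norm N)
  x x' : N (x - x') = N (x' - x).
Proof. by rewrite -(normN hN (x - x')) opprB. Qed.

Lemma norm_sum (R : realType) (V : lmodType R) (N : V -> R) (hN : is_norm N)
  (I : finType) (F : I -> V) : N (\sum_i F i) <= \sum_i N (F i).
Proof.
have [_ _ hD] := hN.
elim/big_ind2 : _ => [|x a x' b ha hb|//]; first by rewrite (norm0 hN).
by apply: (le_trans (hD _ _)); exact: lerD.
Qed.

Lemma norm_le_mx_norm (R : realType) n (N : 'cV[R]_n -> R) :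
  is_norm N -> exists2 K, 0 < K & forall x, N x <= K * `|x|.
Proof.
move=> hN; have [_ hZ _] := hN.
(* The summand 1 keeps the constant positive when [n = 0]. *)
exists (1 + \sum_i N (delta_mx i 0)) => [|x].
  by rewrite ltr_pwDl ?sumr_ge0 // => i _; exact: (norm_ge0 hN).
have {1}-> : x = \sum_i x i 0 *: delta_mx i 0.
  by rewrite {1}[x]matrix_sum_delta; apply: eq_bigr => i _; rewrite big_ord1.
apply: (le_trans (norm_sum hN _)).
rewrite mulrDl mul1r ler_wpDl // mulr_suml.
apply: ler_sum => i _; rewrite hZ mulrC ler_wpM2l ?(norm_ge0 hN) //.
rewrite [leRHS]/Num.Def.normr /= mx_normrE.
exact: (le_bigmax _ (fun ij : 'I_n * 'I_1 => `|x ij.1 ij.2|) (i, 0)).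
Qed.

Lemma norm_lipschitz (R : realType) (V : lmodType R) (N : V -> R) x x' :
  is_norm N -> `|N x - N x'| <= N (x - x').
Proof.
move=> hN; have [_ _ hD] := hN.
have h1 := hD (x - x') x'; have h2 := hD (x' - x) x.
rewrite !subrK (normBC hN x' x) in h1 h2; rewrite ler_norml.
by apply/andP; split; lra.
Qed.

Lemma lipschitz_within_continuous (R : realType) (V W : normedModType R)
    (A : set V) (f : V -> W) K :
  (forall x x', A x -> A x' -> `|f x - f x'| <= K * `|x - x'|) ->
  {within A, continuous f}.
Proof.
move=> hf; apply/subspace_continuousP => x Ax.
apply/cvgrPdist_lt => e e0; near=> x'.
have Ax' : A x' by near: x'; exact: withinT.
(* [K] may be zero or negative, so a positive majorant is used as divisor. *)
have K1 : 0 < `|K| + 1 by rewrite ltr_pwDr.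
apply: (le_lt_trans (hf _ _ Ax Ax')).
apply: (@le_lt_trans _ _ ((`|K| + 1) * `|x - x'|)).
  by rewrite ler_wpM2r // ler_wpDr // ler_norm.
rewrite -ltr_pdivlMl //; near: x'.
by apply: cvg_within; apply: cvgr_dist_lt => //; rewrite mulr_gt0 ?invr_gt0.
Unshelve. all: by end_near. Qed.

Lemma lipschitz_continuous (R : realType) (V W : normedModType R)
    (f : V -> W) K :
  (forall x x', `|f x - f x'| <= K * `|x - x'|) -> continuous f.
Proof.
move=> hf; apply/continuous_subspace_setT.
by apply: (@lipschitz_within_continuous _ _ _ _ _ K).
Qed.

Lemma is_norm_continuous (R : realType) n (N : 'cV[R]_n -> R) :
  is_norm N -> continuous N.
Proof.
move=> hN; have [K K0 hK] := norm_le_mx_norm hN.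
apply: (@lipschitz_continuous R 'cV[R]_n R^o _ K) => x x'.
exact: le_trans (norm_lipschitz _ _ hN) (hK _).
Qed.

Lemma mx_norm_trmx (R : realType) m n (A : 'M[R]_(m, n)) : `|A^T| = `|A|.
Proof.
rewrite /Num.Def.normr /= !mx_normrE; apply/eqP; rewrite eq_le.
apply/andP; split; apply: bigmax_le; rewrite ?bigmax_ge_id // => -[i j] _ /=.
  rewrite mxE.
  exact: (le_bigmax _ (fun ij : 'I_m * 'I_n => `|A ij.1 ij.2|) (j, i)).
have := le_bigmax 0 (fun ij : 'I_n * 'I_m => `|A^T ij.1 ij.2|) (j, i).
by rewrite /= mxE.
Qed.

Lemma trmx_continuous (R : realType) m n :
  continuous (fun A : 'M[R]_(m, n) => A^T).
Proof.
apply: (@lipschitz_continuous R 'M[R]_(m, n) 'M[R]_(n, m) _ 1) => A B.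
rewrite mul1r; have := mx_norm_trmx (A - B); rewrite linearB /=.
by move/eqP; rewrite eq_le => /andP[].
Qed.

(** Heine-Borel for rows, carried over by transposition, which preserves the sup norm. *)
Lemma cV_bounded_closed_compact (R : realType) n (A : set 'cV[R]_n) :
  bounded_set A -> closed A -> compact A.
Proof.
move=> bA cA.
have -> : A = (fun x : 'rV[R]_n => x^T) @` ((fun x => x^T) @^-1` A).
  apply/seteqP; split=> [x Ax|_ [x Ax <-]//].
  by exists x^T; rewrite /= trmxK.
apply: continuous_compact.
  by apply: continuous_subspaceT; exact: trmx_continuous.
apply: bounded_closed_compact.
  move: bA; rewrite /bounded_set /bounded_near; apply: filterS => M hM x Ax.
  by have /= := hM _ Ax; have /= -> := mx_norm_trmx x.
by apply: closed_comp => // x _; exact: trmx_continuous.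
Qed.

(** [N] attains a positive minimum on the compact unit sphere of the sup norm; homogeneity extends
    the resulting bound to all vectors. *)
Lemma mx_norm_le_norm (R : realType) n (N : 'cV[R]_n -> R) :
  is_norm N -> exists2 C, 0 < C & forall x, `|x| <= C * N x.
Proof.
move=> hN; have [h0 hZ _] := hN.
pose S : set 'cV[R]_n := [set x | `|x| = 1].
have nS x : x != 0 -> S (`|x|^-1 *: x).
  move=> x0; rewrite /S /= normrZ normfV normr_id mulVf //.
  by rewrite normr_eq0.
(* The sphere is empty only if every vector is 0, and then any constant works. *)
have [S0|/set0P/negP/negPn/eqP S0] := pselect (S !=set0); last first.
  exists 1 => // x; have [->|/nS] := eqVneq x 0.
    by rewrite normr0 (norm0 hN) mulr0.
  by rewrite S0.
have cS : compact S.
  apply: cV_bounded_closed_compact.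
    by exists 1; split => // M M1 x Sx /=; rewrite Sx ltW.
  apply: (@closed_comp _ _ (fun x : 'cV[R]_n => `|x|) [set 1]).
    by move=> x _; exact: (@norm_continuous _ 'cV[R]_n).
  exact: closed_eq.
have [c] := compact_EVT_min S0 cS
  (continuous_subspaceT (is_norm_continuous hN)).
rewrite inE => Sc hc.
have Nc : 0 < N c.
  rewrite lt_def (norm_ge0 hN) andbT; apply/eqP => /h0 c0.
  by move: Sc; rewrite /S /= c0 normr0; apply/eqP; rewrite eq_sym oner_eq0.
exists (N c)^-1; rewrite ?invr_gt0 // => x.
rewrite ler_pdivlMl //; have [->|x0] := eqVneq x 0.
  by rewrite normr0 (norm0 hN) mulr0.
have := hc _ (mem_set (nS _ x0)); rewrite hZ normfV normr_id.
by rewrite ler_pdivlMl ?normr_gt0 // mulrC.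
Qed.

Lemma norm_cball_compact (R : realType) n (N : 'cV[R]_n -> R)
    (p : 'cV[R]_n) (r : R) :
  is_norm N -> compact [set x | N (x - p) <= r].
Proof.
move=> hN; have [C C0 hC] := mx_norm_le_norm hN.
apply: cV_bounded_closed_compact.
  exists (C * r + `|p|); split=> [|M hM x /= Nx]; first exact: num_real.
  apply: (le_trans _ (ltW hM)); rewrite -{1}(subrK p x).
  apply: (le_trans (ler_normD _ _)); rewrite lerD2r.
  by apply: (le_trans (hC _)); rewrite ler_pM2l.
apply: (@closed_comp _ _ (fun x : 'cV[R]_n => N (x - p)) [set a | a <= r]).
  move=> x _; have [K K0 hK] := norm_le_mx_norm hN.
  apply: (@lipschitz_continuous R 'cV[R]_n R^o _ K) => z z'.
  apply: (le_trans (norm_lipschitz _ _ hN)).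
  by rewrite opprB addrA subrK; exact: hK.
exact: closed_le.
Qed.

(* Compactness replaces the iteration: a minimiser of N (G x - x) is fixed,
   since passing from x to G x shrinks this quantity by the factor q. *)
Lemma norm_contraction_fixpoint (R : realType) n (N : 'cV[R]_n -> R)
    (G : 'cV[R]_n -> 'cV[R]_n) (p : 'cV[R]_n) (r q : R) :
  is_norm N -> 0 <= r -> 0 <= q < 1 ->
  (forall x, N (x - p) <= r -> N (G x - p) <= r) ->
  (forall x x', N (x - p) <= r -> N (x' - p) <= r ->
    N (G x - G x') <= q * N (x - x')) ->
  exists2 x, N (x - p) <= r & G x = x.
Proof.
move=> hN r0 /andP[q0 q1] Gr Gq; have [h0 hZ hD] := hN.
pose B := [set x | N (x - p) <= r].
have B0 : B !=set0 by exists p; rewrite /B /= subrr (norm0 hN).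
have cG : {within B, continuous (fun x => N (G x - x))}.
  have [K K0 hK] := norm_le_mx_norm hN.
  (* The displacement [G x - x] has Lipschitz constant at most [q + 1 <= 2] in [N]. *)
  apply: (@lipschitz_within_continuous R 'cV[R]_n R^o _ _ (2 * K)).
  move=> x x' Bx Bx'.
  apply: (le_trans (norm_lipschitz _ _ hN)).
  rewrite (_ : _ - _ = (G x - G x') + (x' - x)); last first.
    by apply/colP => i; rewrite !mxE; ring.
  apply: (le_trans (hD _ _)); rewrite (normBC hN x').
  have hq := Gq _ _ Bx Bx'; have := hK (x - x').
  have := norm_ge0 hN (x - x'); nra.
have [x] := compact_EVT_min B0 (norm_cball_compact hN) cG.
rewrite inE => Bx hx; exists x => //.
have BGx := Gr _ Bx.
have h1 := hx _ (mem_set BGx).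
have h2 := Gq _ _ BGx Bx; have h3 := norm_ge0 hN (G x - x).
by apply/eqP; rewrite -subr_eq0; apply/eqP/h0; nra.
Unshelve. all: by end_near. Qed.

(** * Mean value inequality in an arbitrary norm *)

Lemma norm_increment_le (R : realType) (V : lmodType R) (N : V -> R)
    (g : R -> V) (a b C : R) :
  is_norm N -> a <= b ->
  (forall t, a <= t <= b ->
    \forall s \near t, N (g s - g t) <= C * `|s - t|) ->
  N (g b - g a) <= C * (b - a).
Proof.
move=> hN ab hg; have [_ _ hD] := hN.
(* Continuous induction: the supremum [c] of the times at which the bound holds belongs to [S], and
   cannot lie strictly before [b]. *)
pose S := [set t | a <= t <= b /\ N (g t - g a) <= C * (t - a)].
have Sa : S a by rewrite /S /= lexx ab !subrr mulr0 (norm0 hN).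
have hS : has_sup S.
  by split; [exists a|exists b => t [/andP[]]].
pose c := sup S.
have ac : a <= c by exact: sup_ubound hS.2 _ Sa.
have cb : c <= b by apply: sup_le_ub; [exists a|move=> t [/andP[]]].
have [d /= d0 hd] : exists2 d, 0 < d &
    forall s, `|s - c| < d -> N (g s - g c) <= C * `|s - c|.
  have /nbhs_ballP[d /= d0 hd] := hg c (introT andP (conj ac cb)).
  by exists d => // s sd; apply: hd; rewrite /ball /= distrC.
have step s t : N (g s - g t) <= C * (s - t) -> N (g t - g a) <= C * (t - a) ->
    N (g s - g a) <= C * (s - a).
  move=> h1 h2; rewrite -(subrK (g t) (g s)) -addrA.
  by apply: (le_trans (hD _ _)); lra.
have Sc : N (g c - g a) <= C * (c - a).
  (* A point of [S] within [d] of [c] is joined to [c] by the local bound at [c]. *)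
  have [t St ct] := sup_adherent d0 hS; rewrite -/c in ct.
  have tc : t <= c by exact: sup_ubound hS.2 _ St.
  apply: (@step _ t); last by case: St.
  rewrite (normBC hN); have := hd t; rewrite distrC ger0_norm ?subr_ge0 //.
  by apply; lra.
have [bc|cltb] := leP b c.
  by rewrite (_ : b = c) //; apply/eqP; rewrite eq_le bc cb.
(* If [c < b], the same local bound reaches a point of [S] beyond [c], a contradiction. *)
pose s := Num.min b (c + d / 2).
have cs : c < s by rewrite /s lt_min cltb /=; lra.
have sd : s <= c + d / 2 by rewrite /s ge_min lexx orbT.
have : S s.
  split; first by rewrite (le_trans ac (ltW cs)) /s ge_min lexx.
  apply: (@step _ c) => //.
  have := hd s; rewrite ger0_norm; last by rewrite subr_ge0 ltW.
  by apply; lra.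
by move=> /(sup_ubound hS.2); rewrite -/c leNgt cs.
Qed.

(** Differentiability gives the local increment bound only with a slack [d > 0] added to [C]; the
    slack then tends to 0. Working with [N] itself, not with coordinates, keeps the constant
    sharp. *)
Lemma norm_derive_le (R : realType) m (N : 'cV[R]_m -> R)
    (g : R -> 'cV[R]_m) (a b C : R) :
  is_norm N -> a <= b ->
  (forall t, a <= t <= b -> derivable g t 1) ->
  (forall t, a <= t <= b -> N ('D_1 g t) <= C) ->
  N (g b - g a) <= C * (b - a).
Proof.
move=> hN ab dg hC; have [_ hZ hD] := hN.
have [K K0 hK] := norm_le_mx_norm hN.
have main d : 0 < d -> N (g b - g a) <= (C + d) * (b - a).
  move=> d0; apply: (norm_increment_le hN ab) => t tab.
  have dgt : h^-1 *: (g (h *: 1 + t) - g t) @[h --> 0^'] --> 'D_1 g t.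
    exact: dg t tab.
  (* By [hK], a sup-norm error below [d / K] is an error of at most [d] in [N]. *)
  have dK : 0 < d / K by rewrite divr_gt0.
  move/cvgrPdist_lt: dgt => /(_ _ dK); rewrite near_withinE.
  move=> /nbhs_ballP[e /= e0 he].
  apply/nbhs_ballP; exists e => //= s ts.
  have [->|st] := eqVneq s t; first by rewrite !subrr (norm0 hN) normr0 mulr0.
  have st0 : s - t != 0 by rewrite subr_eq0.
  have hq : `|'D_1 g t - (s - t)^-1 *: (g s - g t)| < d / K.
    rewrite -[in g s](subrK t s) -[X in X + t]mulr1; apply: he => //.
    by rewrite /ball /= sub0r normrN distrC.
  rewrite -ler_pdivrMr ?normr_gt0 // mulrC -normfV -hZ.
  set z := _ *: _ in hq *.
  have := hD ('D_1 g t) (z - 'D_1 g t); rewrite addrC subrK => /le_trans; apply.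
  apply: lerD; first exact: hC.
  rewrite (normBC hN); apply: (le_trans (hK _)).
  by rewrite -ler_pdivlMl // mulrC ltW.
have [ba|altb] := leP b a.
  rewrite (_ : b = a) ?subrr ?(norm0 hN) ?mulr0 //.
  by apply/eqP; rewrite eq_le ba ab.
apply/ler_addgt0Pr => d d0.
have ba0 : 0 < b - a by rewrite subr_gt0.
have := main (d / (b - a)); rewrite divr_gt0 // => /(_ isT).
by rewrite mulrDl divfK // gt_eqF.
Qed.

(** * Jacobians, partial derivatives and mean value theorems *)

Lemma is_derive_mx (R : realType) m n (c : R -> 'M[R]_(m, n)) (t : R)
    (L : 'M[R]_(m, n)) :
  (forall i j, is_derive t 1 (fun s => c s i j : R) (L i j)) ->
  is_derive t 1 c L.
Proof.
move=> h; have dc : derivable c t 1.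
  by apply/derivable_mxP => i j; have [] := h i j.
apply: DeriveDef => //; rewrite derive_mx //.
by apply/matrixP => i j; rewrite mxE; have [] := h i j.
Qed.

Lemma is_derive_coord (R : realType) m n (c : R -> 'M[R]_(m, n)) (t : R)
    (L : 'M[R]_(m, n)) i j :
  is_derive t 1 c L -> is_derive t 1 (fun s => c s i j : R) (L i j).
Proof.
move=> [dc <-]; apply: DeriveDef; first by move/derivable_mxP: dc.
by rewrite derive_mx // mxE.
Qed.

Lemma is_derive_line (R : realType) (V W : normedModType R) (f : V -> W)
    (a u : V) (t : R) :
  differentiable f (a + t *: u) ->
  is_derive t 1 (fun s : R => f (a + s *: u)) ('d f (a + t *: u) u).
Proof.
move=> df.
have dg : is_diff t (fun s : R => a + s *: u) (fun s : R => 0 + s *: u).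
  exact: is_diffD.
have dfg : is_diff t (f \o (fun s : R => a + s *: u))
    ('d f (a + t *: u) \o (fun s : R => 0 + s *: u)).
  by apply: is_diff_comp.
have [d1 d2] := dfg.
apply: DeriveDef; first exact: diff_derivable.
by rewrite deriveE // d2 /= add0r scale1r.
Qed.

(** The columns of [d_space] are the values of the differential at the basis vectors, by
    differentiation along coordinate lines; linearity does the rest. *)
Lemma d_spaceM (R : realType) m n (f : R -> 'cV[R]_n -> 'cV[R]_m) e
    (x u : 'cV[R]_n) :
  differentiable (f e) x -> 'd (f e) x u = d_space f e x *m u.
Proof.
move=> df.
have jac i j : 'd (f e) x (delta_mx j 0) i 0 = d_space f e x i j.
  rewrite mxE; have := @is_derive_line _ _ _ (f e) x (delta_mx j 0) 0.
  rewrite scale0r addr0 => /(_ df) /(is_derive_coord i 0) [_ <-].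
  rewrite /derive /= scale0r addr0.
  by under eq_fun do rewrite [_%:A]mulr1 addr0 [x + _]addrC.
apply/colP => i; rewrite mxE.
have {1}-> : u = \sum_j u j 0 *: delta_mx j 0.
  by rewrite {1}[u]matrix_sum_delta; apply: eq_bigr => j _; rewrite big_ord1.
rewrite linear_sum summxE; apply: eq_bigr => j _.
by rewrite linearZ mxE jac mulrC.
Qed.

Lemma is_diff_section (R : realType) (V W : normedModType R) (F : R * V -> W)
    e x :
  differentiable F (e, x) ->
  is_diff x (fun z => F (e, z)) (fun u => 'd F (e, x) (0, u)).
Proof.
move=> dF.
have dg : is_diff x (fun z : V => (e, z)) (fun u : V => (0, u)).
  exact: (@is_diff_pair _ _ _ _ (cst e) 0 id id).
exact: (@is_diff_comp _ _ _ _ (fun z : V => (e, z)) _ F).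
Qed.

Lemma derivable_section (R : realType) (V W : normedModType R)
    (F : R * V -> W) e x :
  differentiable F (e, x) -> derivable (fun s => F (s, x)) e 1.
Proof.
move=> dF; apply: diff_derivable.
have dg : differentiable (fun s : R => (s, x)) e.
  exact: differentiable_pair.
exact: (@differentiable_comp _ _ _ _ (fun s : R => (s, x)) F).
Qed.

(** The entry is a component of the total differential in the fixed direction [(0, delta_mx j 0)],
    which is differentiable in [(e, x)] jointly. *)
Lemma derivable_d_space (R : realType) m n (f : R -> 'cV[R]_n -> 'cV[R]_m)
    e x i j :
  is_C2 (fun z : R * 'cV[R]_n => f z.1 z.2) ->
  derivable (fun s => d_space f s x i j : R) e 1.
Proof.
case=> [[d1 _]] /(_ (0, delta_mx j 0)) [d2 _].
have dsec s : is_diff x (f s)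
    (fun u => 'd (fun z : R * 'cV[R]_n => f z.1 z.2) (s, x) (0, u)).
  exact: (is_diff_section (d1 (s, x))).
have -> : (fun s => d_space f s x i j) = fun s =>
    'd (fun z : R * 'cV[R]_n => f z.1 z.2) (s, x) (0, delta_mx j 0) i 0.
  apply/funext => s; have [df deq] := dsec s.
  have := d_spaceM (delta_mx j 0) df; rewrite deq => ->.
  by rewrite -colE [RHS]mxE.
by have /derivable_mxP := derivable_section (d2 (e, x)); exact.
Qed.

(** The scalar mean value theorem is applied to each component, so each row of [M] is taken at its
    own point of the segment. Interval enclosures tolerate this mixing. *)
Lemma d_space_mvt (R : realType) m n (f : R -> 'cV[R]_n -> 'cV[R]_m)
    e (x x' : 'cV[R]_n) :
  (forall z, differentiable (f e) z) ->
  exists2 M : 'M[R]_(m, n), f e x - f e x' = M *m (x - x') &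
    forall i, exists2 t, 0 <= t <= 1 &
      forall j, M i j = d_space f e (x' + t *: (x - x')) i j.
Proof.
move=> df; pose u := x - x'.
have xu : x' + u = x by rewrite addrC subrK.
have mvt i : exists t : R, 0 <= t <= 1 /\
    f e x i 0 - f e x' i 0 = (d_space f e (x' + t *: u) *m u) i 0.
  have dg (t : R) : is_derive t 1 (fun s : R => f e (x' + s *: u) i 0 : R)
      ((d_space f e (x' + t *: u) *m u) i 0).
    rewrite -d_spaceM //; apply: is_derive_coord; exact: is_derive_line.
  have [|t] := MVT_segment ler01 (fun t _ => dg t).
    by apply: derivable_within_continuous => t _; have [] := dg t.
  rewrite in_itv /= scale1r scale0r addr0 xu subr0 mulr1 => t01 h.
  by exists t.
have [t ht] := choice mvt.
exists (\matrix_(i, j) d_space f e (x' + t i *: u) i j).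
  apply/colP => i; have [_ h] := ht i; rewrite [LHS]mxE [X in _ + X]mxE.
  rewrite h [LHS]mxE [RHS]mxE.
  by apply: eq_bigr => j _; congr (_ * _); rewrite [RHS]mxE.
by move=> i; exists (t i); [case: (ht i)|move=> j; rewrite mxE].
Qed.

Lemma d_param_space_mvt (R : realType) m n (f : R -> 'cV[R]_n -> 'cV[R]_m)
    e x i j :
  is_C2 (fun z : R * 'cV[R]_n => f z.1 z.2) -> 0 <= e ->
  exists2 s, 0 <= s <= e &
    d_space f e x i j - d_space f 0 x i j = e * d_param_space f s x i j.
Proof.
move=> hf e0.
have dg (s : R) : is_derive s 1 (fun s => d_space f s x i j : R)
    (d_param_space f s x i j).
  rewrite mxE; apply: derivableP; exact: derivable_d_space.
have [|s] := MVT_segment e0 (fun s _ => dg s).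
  by apply: derivable_within_continuous => s _; have [] := dg s.
by rewrite in_itv /= subr0 mulrC => se h; exists s.
Qed.

Lemma d_space_eq0 (R : realType) m n (f : R -> 'cV[R]_n -> 'cV[R]_m) e
    (x : 'cV[R]_n) :
  (\forall z \near x, f e z = 0) -> d_space f e x = 0.
Proof.
move=> h; apply/matrixP => i j; rewrite !mxE.
rewrite -[RHS](derive_cst (0 : R) x (delta_mx j 0 : 'cV[R]_n)).
apply: near_eq_derive.
by apply: filterS h => z ->; rewrite mxE.
Qed.

Lemma d_paramE (R : realType) m n (f : R -> 'cV[R]_n -> 'cV[R]_m) e x :
  derivable (fun s => f s x) e 1 -> d_param f e x = 'D_1 (fun s => f s x) e.
Proof.
by move=> df; rewrite derive_mx //; apply/colP => i; rewrite !mxE.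
Qed.

(** * Balls, tangent spaces of graphs and transversality *)

Lemma near_norm_ball (R : realType) n (N : 'cV[R]_n -> R) (p x : 'cV[R]_n)
    (r : R) :
  is_norm N -> norm_ball N p r x -> \forall z \near x, norm_ball N p r z.
Proof.
rewrite /norm_ball /= => hN xr; have [_ _ hD] := hN.
have [K K0 hK] := norm_le_mx_norm hN.
have d0 : 0 < (r - N (x - p)) / K by rewrite divr_gt0 // subr_gt0.
apply/nbhs_normP; exists ((r - N (x - p)) / K) => //= z /= xz.
rewrite -(subrK x z) -addrA; apply: (le_lt_trans (hD _ _)).
rewrite -ltrBrDr (normBC hN); apply: (le_lt_trans (hK _)).
by rewrite -ltr_pdivlMl // mulrC.
Qed.

Lemma norm_ball_convex (R : realType) (V : lmodType R) (N : V -> R) (p : V)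
    (r : R) x x' (t : R) :
  is_norm N -> 0 <= t <= 1 -> norm_ball N p r x -> norm_ball N p r x' ->
  norm_ball N p r (x' + t *: (x - x')).
Proof.
rewrite /norm_ball /= => hN /andP[t0 t1] xr xr'; have [_ hZ hD] := hN.
have -> : x' + t *: (x - x') - p = (1 - t) *: (x' - p) + t *: (x - p).
  rewrite scalerBl scale1r -[RHS]addrA -scalerN -scalerDr opprB.
  by rewrite [p - x' + _]addrC addrA subrK addrAC.
apply: (le_lt_trans (hD _ _)); rewrite !hZ !ger0_norm ?subr_ge0 //.
(* Strictness comes from [x'], of weight [1 - t > 0], or from [x] when [t = 1]. *)
have [tlt|tge] := ltP t 1; first by nra.
by have -> : t = 1; lra.
Qed.

(** The line through [x] with velocity [u], lifted to the graph, is the required curve; it stays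
    over [U] for small times. *)
Lemma tangent_space_graph (R : realType) m n (U : set 'cV[R]_n)
    (f : 'cV[R]_n -> 'cV[R]_m) (x u : 'cV[R]_n) :
  (\forall z \near x, U z) -> differentiable f x ->
  tangent_space (graph_over U f) (col_mx x (f x)) (col_mx u ('d f x u)).
Proof.
move=> xU df.
have line0 : x + (0 : R) *: u = x by rewrite scale0r addr0.
exists (fun t : R => col_mx (x + t *: u) (f (x + t *: u))).
split.
- by rewrite line0.
- have cl : x + t *: u @[t --> (0 : R)] --> x.
    have [dl _] : is_diff (0 : R) (fun s : R => x + s *: u)
        (fun s : R => 0 + s *: u) by exact: is_diffD.
    by rewrite -[X in _ --> X]line0; exact: differentiable_continuous dl.
  have Ul : \forall t \near (0 : R), U (x + t *: u) by exact: cl.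
  by apply: filterS Ul => t Ut; exists (x + t *: u).
apply: is_derive_mx => i j; rewrite mxE.
case: (fintype.splitP i) => k ik.
  have -> : i = lshift m k by exact: val_inj.
  under eq_fun do rewrite col_mxEu.
  apply: (@is_derive_coord _ _ _ (fun s : R => x + s *: u)).
  by have := @is_derive_line _ _ _ id x u 0; rewrite diff_val; apply.
have -> : i = rshift n k by exact: val_inj.
under eq_fun do rewrite col_mxEd.
apply: (@is_derive_coord _ _ _ (fun s : R => f (x + s *: u))).
have := @is_derive_line _ _ _ f x u 0; rewrite line0; exact.
Qed.

Lemma transversal_graphs (R : realType) n (U : set 'cV[R]_n)
    (f g : R -> 'cV[R]_n -> 'cV[R]_n) (e : R) (x : 'cV[R]_n) :
  (\forall z \near x, U z) -> differentiable (f e) x ->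
  differentiable (g e) x -> f e x = g e x ->
  d_space f e x - d_space g e x \in unitmx ->
  transversal_at (graph_over U (f e)) (graph_over U (g e))
    (col_mx x (f e x)).
Proof.
move=> xU df dg fg.
have tf u : tangent_space (graph_over U (f e)) (col_mx x (f e x))
    (col_mx u (d_space f e x *m u)).
  by rewrite -(d_spaceM u df); exact: tangent_space_graph.
have tg u : tangent_space (graph_over U (g e)) (col_mx x (f e x))
    (col_mx u (d_space g e x *m u)).
  by rewrite -(d_spaceM u dg) fg; exact: tangent_space_graph.
move: (d_space f e x) (d_space g e x) tf tg => A B tf tg uAB.
apply/seteqP; split=> // z _.
pose a := usubmx z; pose b := dsubmx z.
(* To write [(a, b)] as [(u, A u) + (a - u, B (a - u))], one solves [(A - B) u = b - B a]. *)
pose u := invmx (A - B) *m (b - B *m a).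
exists (col_mx u (A *m u)) => //; exists (col_mx (a - u) (B *m (a - u))) => //.
rewrite add_col_mx [u + _]addrC subrK mulmxBr addrCA -mulmxBl (mulKVmx uAB).
by rewrite [B *m a + _]addrC subrK vsubmxK.
Qed.

(** * The max norm, operator norms and m(A) *)

Lemma max_norm_is_norm (R : realType) k1 k2 (N1 : 'cV[R]_k1 -> R)
    (N2 : 'cV[R]_k2 -> R) :
  is_norm N1 -> is_norm N2 -> is_norm (max_norm N1 N2).
Proof.
move=> h1 h2; have [z1 s1 t1] := h1; have [z2 s2 t2] := h2.
rewrite /max_norm; split => [x hx|a x|x x'].
- have [n1 n2] := (norm_ge0 h1 (usubmx x), norm_ge0 h2 (dsubmx x)).
  have : Num.max (N1 (usubmx x)) (N2 (dsubmx x)) <= 0 by rewrite hx.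
  rewrite ge_max => /andP[u0 d0].
  have ux : usubmx x = 0 by apply: z1; apply/eqP; rewrite eq_le n1 u0.
  have dx : dsubmx x = 0 by apply: z2; apply/eqP; rewrite eq_le n2 d0.
  by have := vsubmxK x; rewrite ux dx col_mx0 => <-.
- by rewrite !linearZ /= s1 s2 maxr_pMr.
rewrite !linearD ge_max; apply/andP; split.
  by apply: (le_trans (t1 _ _)); apply: lerD; rewrite le_max lexx.
by apply: (le_trans (t2 _ _)); apply: lerD; rewrite le_max lexx orbT.
Qed.

Section op_norm.
Context (R : realType) (m n : nat) (Nn : 'cV[R]_n -> R) (Nm : 'cV[R]_m -> R).
Context (hn : is_norm Nn) (hm : is_norm Nm).

(** [sup] defaults to 0 on unbounded sets, so boundedness must precede any use of [op_norm] as an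
    upper bound. It follows from the expansion of [x] in the standard basis. *)
Lemma op_norm_has_ubound (A : 'M[R]_(m, n)) :
  has_ubound [set Nm (A *m x) | x in [set x | Nn x <= 1]].
Proof.
have [C C0 hC] := mx_norm_le_norm hn; have [_ sm _] := hm.
exists (C * \sum_j Nm (A *m delta_mx j 0)) => _ [x /= x1 <-].
have {1}-> : x = \sum_j x j 0 *: delta_mx j 0.
  by rewrite {1}[x]matrix_sum_delta; apply: eq_bigr => j _; rewrite big_ord1.
rewrite mulmx_sumr; apply: (le_trans (norm_sum hm _)).
rewrite mulr_sumr; apply: ler_sum => j _.
rewrite -scalemxAr sm ler_wpM2r ?(norm_ge0 hm) //.
apply: (@le_trans _ _ `|x|).
  rewrite [leRHS]/Num.Def.normr /= mx_normrE.
  exact: (le_bigmax _ (fun ij : 'I_n * 'I_1 => `|x ij.1 ij.2|) (j, 0)).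
by apply: (le_trans (hC _)); rewrite ler_piMr // ltW.
Qed.

Lemma op_norm_ge0 (A : 'M[R]_(m, n)) : 0 <= op_norm Nn Nm A.
Proof.
apply: (sup_ubound (op_norm_has_ubound A)); exists 0.
  by rewrite /= (norm0 hn).
by rewrite mulmx0 (norm0 hm).
Qed.

Lemma norm_mulmx_le (A : 'M[R]_(m, n)) x :
  Nm (A *m x) <= op_norm Nn Nm A * Nn x.
Proof.
have [zn sn _] := hn; have [_ sm _] := hm.
have [x0|x0] := eqVneq (Nn x) 0.
  by rewrite (zn _ x0) mulmx0 (norm0 hm) (norm0 hn) mulr0.
have xp : 0 < Nn x by rewrite lt_def x0 (norm_ge0 hn).
rewrite -ler_pdivrMr // mulrC -[_^-1]gtr0_norm ?invr_gt0 // -sm scalemxAr.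
apply: (sup_ubound (op_norm_has_ubound A)).
exists ((Nn x)^-1 *: x) => //=.
by rewrite sn gtr0_norm ?invr_gt0 // mulVf.
Qed.

End op_norm.

Lemma conorm_mul_le (R : realType) n (N : 'cV[R]_n -> R) (A : 'M[R]_n) x :
  is_norm N -> conorm N A * N x <= N (A *m x).
Proof.
move=> hN; rewrite /conorm; case: ifPn => [dA|_]; last first.
  by rewrite mul0r (norm_ge0 hN).
have uA : A \in unitmx by rewrite unitmxE unitfE.
have := norm_mulmx_le hN hN (invmx A) (A *m x); rewrite mulKmx // => h.
(* This norm is 0 when [n = 0]; then [0^-1 = 0] and the left side vanishes. *)
have [->|o0] := eqVneq (op_norm N N (invmx A)) 0.
  by rewrite invr0 mul0r (norm_ge0 hN).
by rewrite ler_pdivrMl // lt_def o0 op_norm_ge0.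
Qed.

(** Nonemptiness excludes the value -oo, and a value +oo would make the left side +oo. Both suprema
    are therefore real, and they serve as [a] and [d]. *)
Lemma set_norms_lt (R : realType) (T T' : Type) (N : T -> R) (N' : T' -> R)
    (S : set T) (S' : set T') (c r m : R) :
  0 < c -> 0 < r -> S !=set0 -> S' !=set0 ->
  (c%:E * set_norm N S + set_norm N' S' * r%:E < m%:E)%E ->
  exists a d, [/\ forall s, S s -> N s <= a, forall s, S' s -> N' s <= d &
    c * a + d * r < m].
Proof.
move=> c0 r0 [s Ss] [s' Ss'].
have hS u : S u -> ((N u)%:E <= set_norm N S)%E.
  by move=> Su; apply: ereal_sup_ubound; exists u.
have hS' u : S' u -> ((N' u)%:E <= set_norm N' S')%E.
  by move=> Su; apply: ereal_sup_ubound; exists u.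
move: (set_norm N S) (set_norm N' S') hS hS' => [a| |] [d| |] hS hS'.
- rewrite -!EFinM -EFinD lte_fin => h; by exists a, d; split.
- by rewrite gt0_mulye ?lte_fin // addey // ltNge leey.
- by have := hS' _ Ss'; rewrite leeNy_eq.
- by rewrite gt0_muley ?lte_fin // -EFinM addye // ltNge leey.
- by rewrite gt0_muley ?gt0_mulye ?lte_fin // ltNge leey.
- by have := hS' _ Ss'; rewrite leeNy_eq.
all: by have := hS _ Ss; rewrite leeNy_eq.
Qed.

(** * Estimates for a single diagonal block *)

Lemma unitmx_ker0 (R : realType) n (A : 'M[R]_n) :
  (forall x : 'cV[R]_n, A *m x = 0 -> x = 0) -> A \in unitmx.
Proof.
(* [kermx] is a left kernel, so injectivity on columns is read off the transpose. *)
move=> h; rewrite -unitmx_tr -row_free_unit -kermx_eq0.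
apply/eqP/row_matrixP => i; rewrite row0.
apply: trmx_inj; rewrite trmx0; apply: h.
rewrite -{1}[A]trmxK -trmx_mul -row_mul mulmx_ker.
by rewrite row0 trmx0.
Qed.

(* What the inequality of a diagonal block provides; m, d and a stand for
   m(A), a bound of Delta and a bound of the derivative along the parameter.
   A block of size 0, for which nothing is assumed, satisfies it with
   m = 1 and d = a = 0. *)
Definition block_bounds (R : realType) (n k : nat) (N : 'cV[R]_n -> R)
    (N0 : 'cV[R]_k -> R) (A : 'M[R]_k) (S : set 'cV[R]_k)
    (Delta : set 'M[R]_(k, n)) (c r m d a : R) : Prop :=
  [/\ [/\ 0 <= d, 0 <= a & c * a + d * r < m * r],
      forall u, m * N0 u <= N0 (A *m u),
      forall s, S s -> N0 s <= a &
      forall D u, Delta D -> N0 (D *m u) <= d * N u].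

Lemma block_boundsP (R : realType) (n k : nat) (N : 'cV[R]_n -> R)
    (N0 : 'cV[R]_k -> R) (A : 'M[R]_k) (S : set 'cV[R]_k)
    (Delta : set 'M[R]_(k, n)) (c r : R) :
  is_norm N -> is_norm N0 -> 0 < c -> 0 < r -> S !=set0 -> Delta !=set0 ->
  ((0 < k)%N ->
    (c%:E * set_norm N0 S + set_norm (op_norm N N0) Delta * r%:E
       < (conorm N0 A * r)%:E)%E) ->
  exists m d a, block_bounds N N0 A S Delta c r m d a.
Proof.
move=> hN h0 c0 r0 S0 D0; case: k N0 A S Delta h0 S0 D0 => [|k] N0 A S Delta.
  move=> h0 _ _ _; have z (u : 'cV[R]_0) : N0 u = 0.
    by rewrite (flatmx0 u) (norm0 h0).
  exists 1, 0, 0; split=> [|u|s _|D u _]; rewrite ?z ?mulr0 ?mul0r //.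
  by split=> //; lra.
move=> h0 S0 D0 /(_ isT) /(set_norms_lt c0 r0 S0 D0)[a [d [ha hd hlt]]].
have [s Ss] := S0; have [D DD] := D0.
exists (conorm N0 A), d, a; split=> //.
- split=> //; first exact: le_trans (op_norm_ge0 hN h0 D) (hd _ DD).
  exact: le_trans (norm_ge0 h0 s) (ha _ Ss).
- by move=> u; exact: conorm_mul_le.
move=> D' u DD'; apply: (le_trans (norm_mulmx_le hN h0 _ _)).
by rewrite ler_wpM2r ?(norm_ge0 hN) //; exact: hd.
Qed.

Lemma block_bounds_lt (R : realType) (n k : nat) (N : 'cV[R]_n -> R)
    (N0 : 'cV[R]_k -> R) A S Delta (c r m d a : R) :
  0 < c -> 0 < r -> block_bounds N N0 A S Delta c r m d a -> d < m.
Proof. by move=> c0 r0 [[d0 a0 h] _ _ _]; nra. Qed.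

Lemma block_bounds_unitmx (R : realType) (n k : nat) (N : 'cV[R]_n -> R)
    (N0 : 'cV[R]_k -> R) A S Delta (c r m d a : R) :
  is_norm N0 -> 0 < c -> 0 < r -> block_bounds N N0 A S Delta c r m d a ->
  A \in unitmx.
Proof.
move=> h0 c0 r0 hb; have dm := block_bounds_lt c0 r0 hb.
have [[d0 _ _] hA _ _] := hb; have [z _ _] := h0.
apply: unitmx_ker0 => u Au; apply: z.
have := hA u; rewrite Au (norm0 h0); have := norm_ge0 h0 u; nra.
Qed.

(** Multiplying the difference of two Newton steps by [A] gives [A (u - u') - (f - f')], which is
    [- D z]: the principal part cancels and only the perturbation remains. *)
Lemma newton_step_le (R : realType) (n k : nat) (N : 'cV[R]_n -> R)
    (N0 : 'cV[R]_k -> R) A S Delta (c r m d a : R) (D : 'M[R]_(k, n))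
    (u u' f f' : 'cV[R]_k) (z : 'cV[R]_n) :
  is_norm N0 -> block_bounds N N0 A S Delta c r m d a -> A \in unitmx ->
  Delta D -> f - f' = A *m (u - u') + D *m z ->
  m * N0 ((u - invmx A *m f) - (u' - invmx A *m f')) <= d * N z.
Proof.
move=> h0 [_ hA _ hD] uA DD ff.
apply: (le_trans (hA _)); rewrite (_ : A *m _ = - (D *m z)).
  by rewrite (normN h0); exact: hD.
have -> : (u - invmx A *m f) - (u' - invmx A *m f') =
    (u - u') - invmx A *m (f - f').
  by rewrite mulmxBr; apply/colP => i; rewrite !mxE; ring.
by rewrite mulmxBr mulKVmx // ff opprD addrA subrr add0r.
Qed.

(** * The two blocks together: invertibility and existence of a zero *)

Section diagonal_blocks.
Context (R : realType) (k1 k2 : nat).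
Context (N1 : 'cV[R]_k1 -> R) (N2 : 'cV[R]_k2 -> R).
Context (h1 : is_norm N1) (h2 : is_norm N2).
Let N := max_norm N1 N2.
Context (A1 : 'M[R]_k1) (A2 : 'M[R]_k2).
Context (S1 : set 'cV[R]_k1) (S2 : set 'cV[R]_k2).
Context (Delta1 : set 'M[R]_(k1, k1 + k2)) (Delta2 : set 'M[R]_(k2, k1 + k2)).
Context (c1 c2 r m1 d1 a1 m2 d2 a2 : R).
Context (c1_gt0 : 0 < c1) (c2_gt0 : 0 < c2) (r_gt0 : 0 < r).
Context (hb1 : block_bounds N N1 A1 S1 Delta1 c1 r m1 d1 a1).
Context (hb2 : block_bounds N N2 A2 S2 Delta2 c2 r m2 d2 a2).

(** On a kernel vector each diagonal term equals minus its perturbation, so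
    [m_i N_i(x_i) <= d_i N(x)] with [d_i < m_i]; the block that realises the max norm forces
    [N x = 0]. The factor [c] allows the lower block to be rescaled. *)
Lemma diagonal_blocks_unitmx (M1 : 'M[R]_(k1, k1 + k2))
    (M2 : 'M[R]_(k2, k1 + k2)) (c : R) :
  c != 0 -> Delta1 (M1 - row_mx A1 0) -> Delta2 (M2 - row_mx 0 A2) ->
  (col_mx M1 (c *: M2) : 'M[R]_(k1 + k2)) \in unitmx.
Proof.
move=> c0 D1 D2; have hN : is_norm N := max_norm_is_norm h1 h2.
apply: unitmx_ker0 => x; rewrite mul_col_mx => Mx.
have : col_mx (M1 *m x) (c *: M2 *m x) = col_mx 0 0 by rewrite Mx col_mx0.
move=> /eq_col_mx[M1x]; rewrite -scalemxAl => /eqP.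
rewrite scaler_eq0 (negbTE c0) /= => /eqP M2x.
have [[d10 _ _] hA1 _ hD1] := hb1; have [[d20 _ _] hA2 _ hD2] := hb2.
have e1 := block_bounds_lt c1_gt0 r_gt0 hb1.
have e2 := block_bounds_lt c2_gt0 r_gt0 hb2.
have b1 : m1 * N1 (usubmx x) <= d1 * N x.
  apply: (le_trans (hA1 _)); apply: le_trans (hD1 _ x D1).
  rewrite mulmxBl M1x sub0r (normN h1) -[in leRHS](vsubmxK x) mul_row_col.
  by rewrite mul0mx addr0.
have b2 : m2 * N2 (dsubmx x) <= d2 * N x.
  apply: (le_trans (hA2 _)); apply: le_trans (hD2 _ x D2).
  rewrite mulmxBl M2x sub0r (normN h2) -[in leRHS](vsubmxK x) mul_row_col.
  by rewrite mul0mx add0r.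
have [z _ _] := hN; apply: z; have := norm_ge0 hN x.
have Nx : N x = Num.max (N1 (usubmx x)) (N2 (dsubmx x)) by [].
rewrite -/N; move: b1 b2; rewrite Nx.
have [_|_] := leP (N1 (usubmx x)) (N2 (dsubmx x)) => b1 b2 n0.
  by apply/eqP; rewrite eq_le n0 andbT; nra.
by apply/eqP; rewrite eq_le n0 andbT; nra.
Qed.

Lemma diagonal_blocks_zero (F : 'cV[R]_(k1 + k2) -> 'cV[R]_(k1 + k2))
    (p : 'cV[R]_(k1 + k2)) :
  N1 (usubmx (F p)) <= c1 * a1 -> N2 (dsubmx (F p)) <= c2 * a2 ->
  (forall x x', norm_ball N p r x -> norm_ball N p r x' ->
    exists D1 D2, [/\ Delta1 D1, Delta2 D2,
      usubmx (F x - F x') = (row_mx A1 0 + D1) *m (x - x') &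
      dsubmx (F x - F x') = (row_mx 0 A2 + D2) *m (x - x')]) ->
  exists2 x, norm_ball N p r x & F x = 0.
Proof.
move=> F1 F2 hF; have hN : is_norm N := max_norm_is_norm h1 h2.
have u1 := block_bounds_unitmx h1 c1_gt0 r_gt0 hb1.
have u2 := block_bounds_unitmx h2 c2_gt0 r_gt0 hb2.
have e1 := block_bounds_lt c1_gt0 r_gt0 hb1.
have e2 := block_bounds_lt c2_gt0 r_gt0 hb2.
have [[d10 a10 lt1] hA1 _ _] := hb1; have [[d20 a20 lt2] hA2 _ _] := hb2.
pose g1 x := usubmx x - invmx A1 *m usubmx (F x).
pose g2 x := dsubmx x - invmx A2 *m dsubmx (F x).
pose G x := col_mx (g1 x) (g2 x).
have GB x x' : norm_ball N p r x -> norm_ball N p r x' ->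
    m1 * N1 (g1 x - g1 x') <= d1 * N (x - x') /\
    m2 * N2 (g2 x - g2 x') <= d2 * N (x - x').
  move=> xr xr'; have [D1 [D2 [DD1 DD2 f1 f2]]] := hF _ _ xr xr'.
  split; [apply: (newton_step_le h1 hb1 u1 DD1)|
          apply: (newton_step_le h2 hb2 u2 DD2)].
  - move: f1; rewrite linearB /= => ->.
    rewrite mulmxDl -{1}(vsubmxK (x - x')) mul_row_col mul0mx addr0.
    by rewrite linearB.
  - move: f2; rewrite linearB /= => ->.
    rewrite mulmxDl -{1}(vsubmxK (x - x')) mul_row_col mul0mx add0r.
    by rewrite linearB.
have NB z z' t : N1 (usubmx z - usubmx z') <= t ->
    N2 (dsubmx z - dsubmx z') <= t -> N (z - z') <= t.
  by rewrite -!linearB /= /N /max_norm ge_max => -> ->.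
(* The least radius for which the estimates [c_i a_i + d_i rho <= m_i rho] hold in both blocks; the
   strict inequalities in the hypotheses give [rho < r]. *)
pose rho := Num.max (c1 * a1 / (m1 - d1)) (c2 * a2 / (m2 - d2)).
have rho1 : c1 * a1 + d1 * rho <= m1 * rho.
  have : c1 * a1 / (m1 - d1) <= rho by rewrite le_max lexx.
  by rewrite ler_pdivrMr ?subr_gt0 // => h; lra.
have rho2 : c2 * a2 + d2 * rho <= m2 * rho.
  have : c2 * a2 / (m2 - d2) <= rho by rewrite le_max lexx orbT.
  by rewrite ler_pdivrMr ?subr_gt0 // => h; lra.
have rho0 : 0 <= rho.
  by rewrite le_max divr_ge0 // ?mulr_ge0 ?subr_ge0 // ltW.
have rhor : rho < r.
  by rewrite gt_max !ltr_pdivrMr ?subr_gt0 //; apply/andP; split; lra.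
have ballr x : N (x - p) <= rho -> norm_ball N p r x.
  by move=> /le_lt_trans; exact.
have pr : norm_ball N p r p by rewrite /norm_ball /= subrr (norm0 hN).
have m10 : 0 < m1 by lra.
have m20 : 0 < m2 by lra.
(* The larger of the contraction factors of the two blocks. *)
pose q := Num.max (d1 / m1) (d2 / m2).
have q01 : 0 <= q < 1.
  rewrite le_max divr_ge0 ?(ltW m10) //= gt_max !ltr_pdivrMr // !mul1r.
  by rewrite e1.
have q1 : d1 <= q * m1 by rewrite -ler_pdivrMr // le_max lexx.
have q2 : d2 <= q * m2 by rewrite -ler_pdivrMr // le_max lexx orbT.
have [_ _ t1] := h1; have [_ _ t2] := h2.
have [||x xr Gx] := norm_contraction_fixpoint hN rho0 q01 (G := G) (p := p).
(* [G x - p] splits into [G x - G p], bounded by contraction, and [G p - p], bounded by the size of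
   [F p]. *)
- move=> x xr; have [b1 b2] := GB _ _ (ballr _ xr) pr.
  apply: NB; rewrite ?col_mxKu ?col_mxKd.
    rewrite -(subrKA (g1 p)); apply: (le_trans (t1 _ _)).
    rewrite -(ler_pM2l m10) mulrDr; apply: le_trans rho1.
    rewrite [leRHS]addrC; apply: lerD.
      exact: le_trans b1 (ler_wpM2l d10 xr).
    apply: le_trans F1; apply: (le_trans (hA1 _)).
    by rewrite /g1 addrC addKr mulmxN mulKVmx // (normN h1).
  rewrite -(subrKA (g2 p)); apply: (le_trans (t2 _ _)).
  rewrite -(ler_pM2l m20) mulrDr; apply: le_trans rho2.
  rewrite [leRHS]addrC; apply: lerD.
    exact: le_trans b2 (ler_wpM2l d20 xr).
  apply: le_trans F2; apply: (le_trans (hA2 _)).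
  by rewrite /g2 addrC addKr mulmxN mulKVmx // (normN h2).
- move=> x x' xr xr'; have [b1 b2] := GB _ _ (ballr _ xr) (ballr _ xr').
  have Nz := norm_ge0 hN (x - x').
  apply: NB; rewrite ?col_mxKu ?col_mxKd.
    rewrite -(ler_pM2l m10); apply: (le_trans b1).
    by rewrite mulrA [m1 * _]mulrC ler_wpM2r.
  rewrite -(ler_pM2l m20); apply: (le_trans b2).
  by rewrite mulrA [m2 * _]mulrC ler_wpM2r.
exists x; first exact: ballr.
(* At a fixed point the Newton correction vanishes, hence so does [F x]. *)
have Fu : usubmx (F x) = 0.
  rewrite -(mulKVmx u1 (usubmx (F x))); have := congr1 usubmx Gx.
  rewrite col_mxKu /g1 => /eqP; rewrite subr_eq addrC -subr_eq subrr eq_sym.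
  by move=> /eqP ->; rewrite mulmx0.
have Fd : dsubmx (F x) = 0.
  rewrite -(mulKVmx u2 (dsubmx (F x))); have := congr1 dsubmx Gx.
  rewrite col_mxKd /g2 => /eqP; rewrite subr_eq addrC -subr_eq subrr eq_sym.
  by move=> /eqP ->; rewrite mulmx0.
by rewrite -(vsubmxK (F x)) Fu Fd col_mx0.
Qed.

End diagonal_blocks.

(** * Interval matrices and the block components of [y] *)

(** An interval matrix is a product, so each entry may have its own witness. This absorbs
    intermediate points that vary with the row or the entry. *)
Lemma interval_matrix_entrywise (R : realType) m n (lo hi M : 'M[R]_(m, n)) :
  (forall i j, exists2 M', interval_matrix lo hi M' & M i j = M' i j) ->
  interval_matrix lo hi M.
Proof. by move=> h i j; have [M' hM' ->] := h i j. Qed.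

(** Translating the blocks and scaling rows by [e > 0] preserves products of intervals. Conditions
    on the two blocks thus define an interval matrix, to which the minimality of the hull
    applies. *)
Lemma interval_matrix_blocks (R : realType) m1 m2 n (lo1 hi1 A : 'M[R]_(m1, n))
    (lo2 hi2 B : 'M[R]_(m2, n)) (e : R) :
  0 < e ->
  [set M : 'M[R]_(m1 + m2, n) | interval_matrix lo1 hi1 (usubmx M - A) /\
     interval_matrix lo2 hi2 (e^-1 *: dsubmx M - B)] =
  interval_matrix (col_mx (lo1 + A) (e *: (lo2 + B)))
    (col_mx (hi1 + A) (e *: (hi2 + B))).
Proof.
move=> e0.
have h1 (a b c d : R) : (a <= d - b <= c) = (a + b <= d <= c + b).
  by rewrite lerBrDr lerBlDr.
have h2 (a b c d : R) :
    (a <= e^-1 * d - b <= c) = (e * (a + b) <= d <= e * (c + b)).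
  by rewrite h1 ler_pdivlMl // ler_pdivrMl.
apply/seteqP; split=> [M [M1 M2] i j|M hM].
  case: (fintype.splitP i) => k ik.
    have -> : i = lshift m2 k by exact: val_inj.
    by rewrite !col_mxEu; have := M1 k j; rewrite !mxE h1.
  have -> : i = rshift m1 k by exact: val_inj.
  by rewrite !col_mxEd; have := M2 k j; rewrite !mxE h2.
split=> k j.
  by have := hM (lshift m2 k) j; rewrite !col_mxEu !mxE h1.
by have := hM (rshift m1 k) j; rewrite !col_mxEd !mxE h2.
Qed.

Lemma d_space_usubmx (R : realType) m1 m2 n
    (f : R -> 'cV[R]_n -> 'cV[R]_(m1 + m2)) e x :
  d_space (fun e x => usubmx (f e x)) e x = usubmx (d_space f e x).
Proof.
apply/matrixP => i j; rewrite !mxE; congr ('D_ _ _ _).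
by apply/funext => z; rewrite mxE.
Qed.

Lemma d_space_dsubmx (R : realType) m1 m2 n
    (f : R -> 'cV[R]_n -> 'cV[R]_(m1 + m2)) e x :
  d_space (fun e x => dsubmx (f e x)) e x = dsubmx (d_space f e x).
Proof.
apply/matrixP => i j; rewrite !mxE; congr ('D_ _ _ _).
by apply/funext => z; rewrite mxE.
Qed.

Lemma d_param_space_dsubmx (R : realType) m1 m2 n
    (f : R -> 'cV[R]_n -> 'cV[R]_(m1 + m2)) e x :
  d_param_space (fun e x => dsubmx (f e x)) e x = dsubmx (d_param_space f e x).
Proof.
apply/matrixP => i j; rewrite [RHS]mxE ![_ i j]mxE [_ _ j]mxE.
congr ('D_ _ _ _); apply/funext => s.
by rewrite d_space_dsubmx mxE.
Qed.

Lemma d_spaceB (R : realType) m n (f g h : R -> 'cV[R]_n -> 'cV[R]_m) e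
    (x : 'cV[R]_n) :
  differentiable (f e) x -> differentiable (g e) x ->
  (forall z, h e z = f e z - g e z) ->
  d_space h e x = d_space f e x - d_space g e x.
Proof.
move=> df dg hfg.
have dc (k : R -> 'cV[R]_n -> 'cV[R]_m) i (u : 'cV[R]_n) :
    differentiable (k e) x -> derivable (fun z => k e z i 0 : R) x u.
  by move=> dk; have /derivable_mxP := @diff_derivable _ _ _ _ _ u dk; exact.
apply/matrixP => i j; rewrite !mxE.
under eq_fun do rewrite hfg mxE [X in _ + X]mxE.
by apply: deriveB; exact: dc.
Qed.

Lemma norm_increment_param_le (R : realType) m n (N : 'cV[R]_m -> R)
    (f : R -> 'cV[R]_n -> 'cV[R]_m) (x : 'cV[R]_n) (e eps a : R) :
  is_norm N -> (forall s, derivable (fun s => f s x) s 1) -> f 0 x = 0 ->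
  0 <= e <= eps ->
  (forall s, image2 (d_param f) [set e | 0 <= e <= eps] [set x] s -> N s <= a)
  -> N (f e x) <= e * a.
Proof.
move=> hN df f0 /andP[e0 eeps] ha.
have := @norm_derive_le R m N (fun s => f s x) 0 e a hN e0 (fun s _ => df s).
rewrite f0 !subr0 mulrC; apply=> s /andP[s0 se].
rewrite -d_paramE //; apply: ha; exists s; last by exists x.
by rewrite /= s0 (le_trans se).
Qed.

Lemma derivable_usubmx (R : realType) m1 m2 (c : R -> 'cV[R]_(m1 + m2))
    (t : R) :
  derivable c t 1 -> derivable (fun s => usubmx (c s)) t 1.
Proof.
move=> dc; apply/derivable_mxP => i j; under eq_fun do rewrite mxE.
by have /derivable_mxP := dc; exact.
Qed.

Lemma derivable_dsubmx (R : realType) m1 m2 (c : R -> 'cV[R]_(m1 + m2))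
    (t : R) :
  derivable c t 1 -> derivable (fun s => dsubmx (c s)) t 1.
Proof.
move=> dc; apply/derivable_mxP => i j; under eq_fun do rewrite mxE.
by have /derivable_mxP := dc; exact.
Qed.

Lemma interval_hull_min (R : realType) m n (S : set 'M[R]_(m, n)) lo hi :
  S `<=` interval_matrix lo hi -> interval_hull S `<=` interval_matrix lo hi.
Proof. by move=> SB M; apply; split=> //; exists lo, hi. Qed.

(** * Block bounds for the family [y], then invertibility, intersection and transversality *)

Theorem lemma6 (R : realType) (k1 k2 : nat)
  (N1 : 'cV[R]_k1 -> R) (N2 : 'cV[R]_k2 -> R)
  (hN1 : is_norm N1) (hN2 : is_norm N2)
  (w v y : R -> 'cV[R]_(k1 + k2) -> 'cV[R]_(k1 + k2))
  (hw : forall e, is_C1 (w e)) (hv : forall e, is_C1 (v e))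
  (hy : forall e x, y e x = w e x - v e x)
  (hyC2 : is_C2 (fun z : R * 'cV[R]_(k1 + k2) => y z.1 z.2))
  (eps : R) (heps : 0 < eps)
  (p : 'cV[R]_(k1 + k2)) (hp : y 0 p = 0)
  (r : R) (hr : 0 < r) :
  let E : set R := [set e | 0 <= e <= eps] in
  let N := max_norm N1 N2 in
  let U := norm_ball N p r in
  let y1 := fun e x => usubmx (y e x) : 'cV[R]_k1 in
  let y2 := fun e x => dsubmx (y e x) : 'cV[R]_k2 in
  let A11 : 'M[R]_k1 := lsubmx (d_space y1 0 p) in
  let A22 : 'M[R]_k2 := rsubmx (d_param_space y2 0 p) in
  forall (Delta1 : set 'M[R]_(k1, k1 + k2)) (Delta2 : set 'M[R]_(k2, k1 + k2)),
  (forall x, U x -> y2 0 x = 0) ->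
  is_enclosure (image2 (fun e x => d_space y1 e x - row_mx A11 0) E U)
    Delta1 ->
  is_enclosure (image2 (fun e x => d_param_space y2 e x - row_mx 0 A22) E U)
    Delta2 ->
  ((0 < k1)%N ->
    (eps%:E * set_norm N1 (image2 (d_param y1) E [set p])
      + set_norm (op_norm N N1) Delta1 * r%:E < (conorm N1 A11 * r)%:E)%E) ->
  ((0 < k2)%N ->
    (set_norm N2 (image2 (d_param y2) E [set p])
      + set_norm (op_norm N N2) Delta2 * r%:E < (conorm N2 A22 * r)%:E)%E) ->
  (* The derivative of y at e = 0 has zero lower block, so E is restricted to a
     single e > 0, or the lower block is divided by e, unless k2 = 0. *)
  [/\ forall M1 M2, Delta1 (M1 - row_mx A11 0) -> Delta2 (M2 - row_mx 0 A22) ->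
        (col_mx M1 M2 : 'M[R]_(k1 + k2)) \in unitmx,
      forall e, 0 < e <= eps ->
        forall M, interval_hull (image2 (d_space y) [set e] U) M ->
        M \in unitmx
    & k2 = 0%N ->
        forall M, interval_hull (image2 (d_space y) E U) M -> M \in unitmx] /\
  (forall e, 0 < e <= eps ->
    let W := graph_over U (w e) in
    let V := graph_over U (v e) in
    exists q, W `&` V = [set q] /\ transversal_at W V q).
Proof.
move=> E N U y1 y2 A11 A22 Delta1 Delta2 hy2 [sD1 [lo1 [hi1 eD1]]].
move=> [sD2 [lo2 [hi2 eD2]]] h1 h2.
have hN : is_norm N := max_norm_is_norm hN1 hN2.
have [[dY _] _] := hyC2.
have dy e x : differentiable (y e) x by have [] := is_diff_section (dY (e, x)).
have dys s x : derivable (fun s => y s x) s 1.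
  exact: (derivable_section (dY (s, x))).
have Up : U p by rewrite /U /norm_ball /= subrr (norm0 hN).
have E0 : E 0 by rewrite /E /= lexx ltW.
have [m1 [d1 [a1 hb1]]] := block_boundsP hN hN1 heps hr
  (ex_intro _ _ (ex_intro2 _ _ 0 E0 (ex_intro2 _ _ p erefl erefl)))
  (ex_intro _ _ (sD1 _ (ex_intro2 _ _ 0 E0 (ex_intro2 _ _ p Up erefl)))) h1.
(* The lower block is divided by the parameter, so its constant [c] is 1 in place of [eps]. *)
have h2' : (0 < k2)%N -> (1%:E * set_norm N2 (image2 (d_param y2) E [set p])
    + set_norm (op_norm N N2) Delta2 * r%:E < (conorm N2 A22 * r)%:E)%E.
  by rewrite mul1e.
have [m2 [d2 [a2 hb2]]] := block_boundsP hN hN2 ltr01 hr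
  (ex_intro _ _ (ex_intro2 _ _ 0 E0 (ex_intro2 _ _ p erefl erefl)))
  (ex_intro _ _ (sD2 _ (ex_intro2 _ _ 0 E0 (ex_intro2 _ _ p Up erefl)))) h2'.
have unit_blocks M1 M2 c := @diagonal_blocks_unitmx R k1 k2 N1 N2 hN1 hN2 A11
  A22 _ _ _ _ _ _ _ _ _ _ _ _ _ heps ltr01 hr hb1 hb2 M1 M2 c.
have in1 e x : E e -> U x ->
    Delta1 (usubmx (d_space y e x) - row_mx A11 0).
  move=> Ee Ux; apply: sD1; exists e => //; exists x => //.
  by rewrite d_space_usubmx.
(* The Jacobian of [y2] vanishes at parameter 0 on the open set [U], so its entries at [e], divided
   by [e], are entries of the mixed derivative at intermediate parameters. *)
have in2 e x : 0 < e <= eps -> U x ->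
    Delta2 (e^-1 *: dsubmx (d_space y e x) - row_mx 0 A22).
  move=> /andP[e0 eeps] Ux; rewrite eD2.
  apply: interval_matrix_entrywise => i j.
  have [s /andP[s0 se]] :=
    d_param_space_mvt x (rshift k1 i) j hyC2 (ltW e0).
  have y20 : d_space y2 0 x = 0.
    by apply: d_space_eq0; apply: filterS (near_norm_ball hN Ux) => z /hy2.
  have -> : d_space y 0 x (rshift k1 i) j = 0.
    have := congr1 (fun M : 'M[R]_(k2, k1 + k2) => M i j) y20.
    by rewrite d_space_dsubmx [LHS]mxE [RHS]mxE.
  rewrite subr0 => des.
  exists (d_param_space y2 s x - row_mx 0 A22).
    rewrite -eD2; apply: sD2; exists s; last by exists x.
    by rewrite /E /= s0 (le_trans se).
  rewrite d_param_space_dsubmx [LHS]mxE [RHS]mxE; congr (_ + _).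
  by rewrite [LHS]mxE [X in _ * X]mxE [RHS]mxE des mulKf // gt_eqF.
(* The block conditions cut out an interval matrix containing [S], hence its hull; multiplying the
   lower block by [e] again recovers [M]. *)
have hull_unit e (S : set 'M[R]_(k1 + k2)) : 0 < e ->
    (forall M, S M -> Delta1 (usubmx M - row_mx A11 0) /\
      Delta2 (e^-1 *: dsubmx M - row_mx 0 A22)) ->
    forall M, interval_hull S M -> M \in unitmx.
  move=> e0 hS M hM.
  have : [set M : 'M[R]_(k1 + k2) |
      interval_matrix lo1 hi1 (usubmx M - row_mx A11 0) /\
      interval_matrix lo2 hi2 (e^-1 *: dsubmx M - row_mx 0 A22)] M.
    rewrite interval_matrix_blocks //; apply: interval_hull_min M hM => M SM.
    by rewrite -interval_matrix_blocks // /= -eD1 -eD2; exact: hS.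
  rewrite /= -eD1 -eD2 => -[D1 D2].
  have := unit_blocks _ _ e _ D1 D2.
  rewrite scalerA divff ?gt_eqF // scale1r vsubmxK; exact.
split; first split.
- by move=> M1 M2 D1 D2; have := unit_blocks _ _ 1 (oner_neq0 _) D1 D2;
    rewrite scale1r.
- move=> e eeps; have /andP[e0 _] := eeps.
  apply: (hull_unit e) => // _ [_ -> [x Ux <-]].
  have Ee : E e by rewrite /E /= ltW //; case/andP: eeps.
  by split; [exact: in1|exact: in2].
(* With no rows below, all lower blocks coincide, and the one at [(0, p)] lies in [Delta2]. *)
- move=> k20; apply: (hull_unit 1) => // _ [e Ee [x Ux <-]].
  split; first exact: in1.
  have := sD2 _ (ex_intro2 _ _ 0 E0 (ex_intro2 _ _ p Up erefl)).
  congr Delta2; apply/matrixP => -[i ik2].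
  by exfalso; move: ik2; rewrite k20.
move=> e eeps W V; have /andP[e0 ee] := eeps.
have Ee : E e by rewrite /E /= ltW.
have e_neq0 : e != 0 by rewrite gt_eqF.
(* The intermediate points of the rows lie in [U] by convexity, so the mean value matrix satisfies
   the same enclosures as the Jacobians. *)
have incr x x' : U x -> U x' -> exists D1 D2, [/\ Delta1 D1, Delta2 D2,
    usubmx (y e x - y e x') = (row_mx A11 0 + D1) *m (x - x') &
    e^-1 *: dsubmx (y e x - y e x') = (row_mx 0 A22 + D2) *m (x - x')].
  move=> Ux Ux'; have [M yM rows] := d_space_mvt x x' (dy e).
  have rowsU i : exists2 z, U z & forall j, M i j = d_space y e z i j.
    have [t t01 ht] := rows i; exists (x' + t *: (x - x')) => //.
    exact: norm_ball_convex.
  exists (usubmx M - row_mx A11 0), (e^-1 *: dsubmx M - row_mx 0 A22).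
  split.
  - rewrite eD1; apply: interval_matrix_entrywise => i j.
    have [z Uz hz] := rowsU (lshift k2 i).
    exists (usubmx (d_space y e z) - row_mx A11 0).
      by rewrite -eD1; exact: in1.
    rewrite [LHS]mxE [RHS]mxE; congr (_ + _).
    by rewrite [LHS]mxE [RHS]mxE hz.
  - rewrite eD2; apply: interval_matrix_entrywise => i j.
    have [z Uz hz] := rowsU (rshift k1 i).
    exists (e^-1 *: dsubmx (d_space y e z) - row_mx 0 A22).
      by rewrite -eD2; exact: in2.
    rewrite [LHS]mxE [RHS]mxE; congr (_ + _).
    rewrite [LHS]mxE [RHS]mxE; congr (_ * _).
    by rewrite [LHS]mxE [RHS]mxE hz.
  - by rewrite yM -mul_usub_mx [row_mx _ _ + _]addrC subrK.
  - by rewrite yM -mul_dsub_mx scalemxAl [row_mx _ _ + _]addrC subrK.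
have y1p : y1 0 p = 0 by rewrite /y1 hp linear0.
have y2p : y2 0 p = 0 by rewrite /y2 hp linear0.
have e0eps : 0 <= e <= eps by rewrite ltW.
have [[d10 a10 _] _ ha1 _] := hb1; have [_ _ ha2 _] := hb2.
pose F x := col_mx (usubmx (y e x)) (e^-1 *: dsubmx (y e x)).
have [x Ux] : exists2 x, U x & F x = 0.
  apply: (diagonal_blocks_zero hN1 hN2 heps ltr01 hr hb1 hb2)
    => [||x x' Ux Ux'].
  (* The upper residual at [p] is at most [e * a1 <= eps * a1]. *)
  - rewrite col_mxKu; apply: le_trans (ler_wpM2r a10 ee).
    apply: (norm_increment_param_le hN1 _ y1p e0eps ha1) => s.
    exact: derivable_usubmx.
  (* The lower residual is at most [e * a2] before the division by [e], and [a2] after it. *)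
  - rewrite col_mxKd mul1r; have [_ sZ _] := hN2.
    rewrite sZ gtr0_norm ?invr_gt0 // ler_pdivrMl //.
    apply: (norm_increment_param_le hN2 _ y2p e0eps ha2) => s.
    exact: derivable_dsubmx.
  have [D1 [D2 [DD1 DD2 f1 f2]]] := incr _ _ Ux Ux'.
  exists D1, D2; split => //; rewrite /F opp_col_mx add_col_mx.
    by rewrite col_mxKu -f1 linearB.
  by rewrite col_mxKd -f2 linearB scalerBr.
rewrite -col_mx0 => /eq_col_mx[yu /eqP].
rewrite scaler_eq0 invr_eq0 (negbTE e_neq0) /= => /eqP yd.
have yx : y e x = 0 by rewrite -(vsubmxK (y e x)) yu yd col_mx0.
have wv z : y e z = 0 -> w e z = v e z.
  by rewrite hy => /eqP; rewrite subr_eq0 => /eqP.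
exists (col_mx x (w e x)); split.
  apply/seteqP; split=> [_ [[z Uz <-] [z' Uz' /eq_col_mx[zz wz]]]|_ ->] /=.
    have yz : y e z = 0 by rewrite hy -wz zz subrr.
    suff -> : z = x by [].
    (* Uniqueness: an invertible mean value matrix sends [z - x] to the difference of two zeros. *)
    have [D1 [D2 [DD1 DD2 f1 f2]]] := incr _ _ Uz Ux.
    have := unit_blocks (row_mx A11 0 + D1) (row_mx 0 A22 + D2) 1 (oner_neq0 _).
    rewrite ![_ + _ - _]addrAC !subrr !add0r scale1r => /(_ DD1 DD2) uM.
    apply/eqP; rewrite -subr_eq0; apply/eqP.
    rewrite -(mulKmx uM (z - x)) mul_col_mx -f1 -f2 yz yx subrr.
    by rewrite !linear0 col_mx0 linear0.
  by split; [exists x|exists x => //; rewrite -wv].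
apply: transversal_graphs; first exact: near_norm_ball.
- by have [] := hw e.
- by have [] := hv e.
- exact: wv.
rewrite -(@d_spaceB _ _ _ w v y) //; last 2 first.
- by have [] := hw e.
- by have [] := hv e.
(* The Jacobian lies in the hull of its own singleton. *)
apply: (hull_unit e [set d_space y e x] e0) => [_ ->|B [+ _]]; last exact.
by split; [exact: in1|exact: in2].
Qed.
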